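(* Let $F$ be a free group of finite rank $n$ and let $R$ be a normal subgroup of $F$ which is generated as a normal subgroup by a finite set. Let $x_1,\dots,x_n$ be a free basis of $F$ and let $w_1,w_2,\dots,w_t,w_{t+1},\dots$ (a finite or infinite sequence) be a free basis of $R$ such that $0\le t\le n$, $w_i\equiv x_i^{d_i} \bmod \gamma_2(F)$ with $d_i$ a nonzero integer for $1\le i\le t$, and $w_i\in\gamma_2(F)$ for $i>t$. Put $W_1=\{w_1,\dots,w_t\}$ and $W_2=\{w_{t+1},w_{t+2},\dots\}$. Then $R$ has free basis $W_1\cup W_2$ and $R\cap\gamma_2(F)$ has free basis $W_2\cup U$, where $U=U(W_1,W_2)$ is the set obtained from $W_1\cup W_2$ by the $U$-construction.
   Context: $\gamma_k(F)$ denotes the $k$-th term of the lower central series of $F$, so $\gamma_2(F)=F'$ is the derived group. Commutators: $[x,y]=x^{-1}y^{-1}xy$, and longer commutators are left-normed, $[x_1,\dots,x_{k+1}]=[[x_1,\dots,x_k],x_{k+1}]$. $U$-construction: let $A,B$ be disjoint subsets of a group with $A\cup B$ totally ordered so that every member of $A$ precedes every member of $B$. Then $U(A,B)$ is the set of all elements $$[b^{\beta},a_1^{\alpha_1},a_2^{\alpha_2},\dots,a_q^{\alpha_q}]$$ with $q\ge 1$, $b\in A\cup B$, $a_i\in A$, $\beta,\alpha_i\in\{+1,-1\}$, $b>a_1\le a_2\le\dots\le a_q$, $\beta=+1$ whenever $b\in B$, and the indices being index coherent: whenever two of the elements $b,a_1,\dots,a_q$ are equal, their exponents are equal. Here $A=W_1$,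 $B=W_2$, with $W_1\cup W_2$ given any total order in which every member of $W_1$ precedes every member of $W_2$. *)

(* Defs.v *)
From mathcomp Require Import all_boot all_order all_algebra.
From mathcomp Require Import all_classical.

Set Implicit Arguments.
Unset Strict Implicit.
Unset Printing Implicit Defensive.

Local Open Scope classical_set_scope.
Local Open Scope group_scope.

(* The groups here may be infinite, so subgroups are classical sets of
   elements of a [groupType] and not MathComp's [{group gT}]. *)
Section Groups.
Variable G : groupType.
Implicit Types (H K N S A B : set G) (le : rel G).

Definition is_subgroup H : Prop := group_closed (mem H).

Definition is_normal_subgroup N : Prop :=
  is_subgroup N /\ (forall x g : G, N x -> N (x ^ g)).

Definition subgroup_generated S : set G := smallest is_subgroup S.

Definition normal_closure S : set G := smallest is_normal_subgroup S.

Definition commutator_subgroup H K : set G :=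
  subgroup_generated [set [~ x, y] | x in H & y in K].

(* The index starts at 1, as usual: gamma 1 = G and gamma 2 = G'.  The value
   gamma 0 = G is a dummy. *)
Fixpoint gamma (k : nat) : set G :=
  match k with
  | 0 | 1 => [set: G]
  | k'.+1 => commutator_subgroup (gamma k') [set: G]
  end.

Definition congruent_mod N (x y : G) : Prop := N (x^-1 * y).

Definition expgz (x : G) (d : int) : G :=
  match d with
  | Posz m => x ^+ m
  | Negz m => x ^- m.+1
  end.

(* A pair (x, e) stands for x when e = false and for x^-1 when e = true, i.e.
   for x to the power (-1)^e. *)
Definition letter : Type := (G * bool)%type.

Definition letter_val (l : letter) : G := if l.2 then l.1^-1 else l.1.

Definition word_val (s : seq letter) : G := \prod_(l <- s) letter_val l.

Definition reduced (s : seq letter) : bool :=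
  sorted (fun u v : letter => (u.1 != v.1) || (u.2 == v.2)) s.

(* S generates H and no nonempty reduced word in S represents 1. *)
Definition free_basis H S : Prop :=
  subgroup_generated S = H /\
  (forall s : seq letter, (forall l, l \in s -> S l.1) ->
     reduced s -> s <> [::] -> word_val s <> 1).

Definition total_order_on S le : Prop :=
  [/\ {in S &, total le}, {in S &, antisymmetric le}
    & {in S & &, transitive le}].

Definition precedes A B le : Prop :=
  forall a b : G, A a -> B b -> le a b && (a != b).

Definition index_coherent (s : seq letter) : Prop :=
  {in s &, forall u v : letter, u.1 = v.1 -> u.2 = v.2}.

(* The condition q >= 1 is expressed by writing the list a_1, ..., a_q as
   a :: s. *)
Definition U_construction le A B : set G :=
  [set g | exists (b a : letter) (s : seq letter),
    [/\ (A `|` B) b.1,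
        (forall l, l \in a :: s -> A l.1),
        le a.1 b.1 && (a.1 != b.1)
      & sorted le [seq l.1 | l <- a :: s]] /\
    [/\ (B b.1 -> b.2 = false),
        index_coherent [:: b, a & s]
      & g = foldl (@commg G) (letter_val b)
              [seq letter_val l | l <- a :: s]]].

End Groups.

(* The index set of a finite sequence of length m (Some m) or of an infinite
   sequence (None), indexed from 0. *)
Definition index_set (N : option nat) : set nat :=
  if N is Some m then `I_m else [set: nat].

(* Main.v *)
Require Import Defs.
From mathcomp Require Import all_boot all_order all_algebra all_fingroup.
From mathcomp Require Import all_classical.
From mathcomp Require Import zify ring.

Set Implicit Arguments.
Unset Strict Implicit.
Unset Printing Implicit Defensive.

Import Order.TTheory GRing.Theory Num.Theory.

Local Open Scope classical_set_scope.
Local Open Scope group_scope.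

(** Let A be the increasing list of the elements of W1, let B = W2 and
    S = A U B, and let K be the intersection of R with the derived group.
    Exponent sums in the free generators x_i are homomorphisms to the integers
    that vanish on the derived group; they show that a monomial
    m(tau) = prod a^(tau a), taken over A in increasing order, lies in K only
    if tau = 0.  Hence the m(tau) are coset representatives of K in R, and K is
    generated by the Schreier generators
      c(y, tau) = m(tau + e_y)^-1 y m(tau)     (e_y = 0 if y is in B),
    where c(y, tau) = 1 unless y is in B or tau is nonzero at some letter of A
    before y.

    The set B U U(A, B) is indexed by the same pairs (y, tau)
    ([ucomm_construction]): tau gives the signed multiplicities of the letters
    a_1, ..., a_q, and for y in A the sign of tau y is the sign of the initial
    letter, so that a negative tau y counts the initial y^-1 as well.  Write
    u(y, tau) for this element.

    Generation.  The identity [x, gh] = [x, h] [x, g]^h yields that c(y, tau)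
    lies in the subgroup generated by the u(y, tau') with |tau'| <= |tau|
    coordinatewise ([schreier_mem]).

    Freeness.  It would be enough to solve a triangular system expressing the
    u's by the c's, but a count avoids writing it down.  As R is free on S,
    every assignment of values in a group Q to the Schreier generators extends
    to a homomorphism from K to Q: let R act on Q x Z^A, where y translates the
    second factor by - e_y and multiplies the first one by the prescribed value
    ([cocycle_hom]).  Let Q be finite and let J be a finite set of
    pairs (y, tau) closed under decreasing |tau|.  The |Q|^|J| homomorphisms
    so obtained are determined by their values at the u's, because the u's
    generate the c's; there are just |Q|^|J| possible families of values, so
    each of them occurs.  Finally a nonempty reduced word survives in some
    finite symmetric group ([reduced_perm]), so that no nonempty reduced word
    in the u's equals 1 ([ucomm_free]). *)

(** * Subgroups as classical sets *)

Section Subgroups.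
Variable G : groupType.
Implicit Types (H K S : set G) (x y g h : G).

Lemma is_subgroupP H :
  is_subgroup H <-> H 1 /\ (forall x y, H x -> H y -> H (x * y^-1)).
Proof.
split=> -[H1 HB]; split.
- by move: H1; rewrite inE.
- by move=> x y Hx Hy; have := HB x y; rewrite !inE; apply.
- by rewrite inE.
- by move=> x y; rewrite !inE; apply: HB.
Qed.

Lemma subgroup1 H : is_subgroup H -> H 1.
Proof. by move/is_subgroupP=> []. Qed.

Lemma subgroupV H x : is_subgroup H -> H x -> H x^-1.
Proof. by move/is_subgroupP=> [H1 HB] Hx; rewrite -[x^-1]mul1g; apply: HB. Qed.

Lemma subgroupM H x y : is_subgroup H -> H x -> H y -> H (x * y).
Proof.
move=> sH Hx Hy; rewrite -[y]invgK; case/is_subgroupP: (sH) => _; apply=> //.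
exact: subgroupV.
Qed.

Lemma subgroup_conj H x g : is_subgroup H -> H x -> H g -> H (x ^ g).
Proof.
by move=> sH Hx Hg; do ![apply: subgroupM => //]; apply: subgroupV.
Qed.

Lemma subgroup_comm H x g : is_subgroup H -> H x -> H g -> H [~ x, g].
Proof.
move=> sH Hx Hg; apply: subgroupM => //; first exact: subgroupV.
exact: subgroup_conj.
Qed.

Lemma subgroup_expgz H x d : is_subgroup H -> H x -> H (expgz x d).
Proof.
move=> sH Hx; have HX m : H (x ^+ m).
  elim: m => [|m IH]; first exact: subgroup1.
  by rewrite expgS; apply: subgroupM.
by case: d => m; rewrite /expgz; [|apply: subgroupV].
Qed.

Lemma subgroup_setI H K : is_subgroup H -> is_subgroup K -> is_subgroup (H `&` K).
Proof.
move=> /is_subgroupP[H1 HB] /is_subgroupP[K1 KB]; apply/is_subgroupP.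
by split=> // x y [Hx Kx] [Hy Ky]; split; [apply: HB | apply: KB].
Qed.

Lemma preim_conj_subgroup H g :
  is_subgroup H -> is_subgroup [set x | H (x ^ g)].
Proof.
move=> /is_subgroupP[H1 HB]; apply/is_subgroupP; split=> /=.
  by rewrite conj1g.
by move=> x y Hx Hy; rewrite conjMg conjVg; apply: HB.
Qed.

Lemma generated_subgroup S : is_subgroup (subgroup_generated S).
Proof.
apply/is_subgroupP; split=> [H [sH _]|x y Sx Sy H HP]; first exact: subgroup1.
case: (HP) => sH _; apply: subgroupM => //; first exact: Sx HP.
by apply: subgroupV => //; exact: Sy HP.
Qed.

Lemma mem_generated S : S `<=` subgroup_generated S.
Proof. exact: sub_gen_smallest. Qed.

Lemma generated_sub S H :
  is_subgroup H -> S `<=` H -> subgroup_generated S `<=` H.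
Proof. exact: smallest_sub. Qed.

Lemma expgzS x d : expgz x (d + 1)%R = expgz x d * x.
Proof.
case: d => [m|[|m]].
- by have -> : (Posz m + 1)%R = Posz m.+1 by [lia]; exact: expgSr.
- by rewrite [LHS]/= mulVg.
have -> : (Negz m.+1 + 1)%R = Negz m by lia.
by rewrite /expgz (expgS x m.+1) invgM mulgVK.
Qed.

Lemma expgz_sign x (d : int) :
  expgz x d = (if (d < 0)%R then x^-1 else x) ^+ absz d.
Proof. by case: d => m //=; rewrite expVgn. Qed.

End Subgroups.

(** * Words, free bases and residual finiteness *)

Section Words.
Variable G : groupType.
Implicit Types (H S : set G) (s : seq (letter G)) (l : letter G).

Definition inv_letter l : letter G := (l.1, ~~ l.2).

Lemma word_val0 : word_val [::] = 1 :> G.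
Proof. exact: big_nil. Qed.

Lemma word_val1 l : word_val [:: l] = letter_val l.
Proof. exact: big_seq1. Qed.

Lemma word_val_cons l s : word_val (l :: s) = letter_val l * word_val s.
Proof. exact: big_cons. Qed.

Lemma word_val_cat s1 s2 : word_val (s1 ++ s2) = word_val s1 * word_val s2.
Proof. exact: big_cat. Qed.

Lemma word_val_inv s : word_val (rev [seq inv_letter l | l <- s]) = (word_val s)^-1.
Proof.
elim: s => [|[x e] s IH] /=; first by rewrite word_val0 invg1.
rewrite rev_cons -cats1 word_val_cat IH word_val1 word_val_cons invgM.
by rewrite /letter_val /=; case: e; rewrite ?invgK.
Qed.

Lemma generated_word S h : subgroup_generated S h ->
  exists2 s, (forall l, l \in s -> S l.1) & word_val s = h.
Proof.
pose H := [set h | exists2 s, (forall l, l \in s -> S l.1) & word_val s = h].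
apply: (@generated_sub _ S H) => [|x Sx].
  apply/is_subgroupP; split; first by exists [::]; rewrite // word_val0.
  move=> _ _ [s Ss <-] [s' Ss' <-]; exists (s ++ rev [seq inv_letter l | l <- s']).
    move=> l; rewrite mem_cat mem_rev => /orP[/Ss //|/mapP[l' /Ss' Sl' ->]] //.
  by rewrite word_val_cat word_val_inv.
exists [:: (x, false)]; first by move=> l; rewrite inE => /eqP->.
by rewrite word_val1.
Qed.

Lemma not_reducedP s : ~~ reduced s ->
  exists s1 l s2, s = s1 ++ [:: l, inv_letter l & s2].
Proof.
elim: s => [//|l [//|l' s] IH] /=; rewrite negb_and => /orP[|/IH].
  rewrite negb_or negbK => /andP[/eqP e1 e2]; exists [::], l, s; congr [:: _, _ & _].
  by case: l l' e1 e2 {IH} => [x e] [x' e'] /= ->; case: e e' => [] [].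
by case=> s1 [k [s2 ->]]; exists (l :: s1), k, s2.
Qed.

(** The universal property of a free basis, stated for right actions on a mere
    type X instead of homomorphisms to a group: no group of bijections of X has
    to be formed. *)
Section Action.
Variables (S H : set G) (X : Type) (f g : G -> X -> X).
Hypothesis bHS : free_basis H S.
Hypothesis fK : forall x, S x -> cancel (f x) (g x).
Hypothesis gK : forall x, S x -> cancel (g x) (f x).

Let lact (z : X) l := if l.2 then g l.1 z else f l.1 z.

Let lactK l : S l.1 -> forall z, lact (lact z l) (inv_letter l) = z.
Proof. by case: l => x [] /= Sx z; rewrite /lact /= ?fK ?gK. Qed.

Let wact_trivial s : (forall l, l \in s -> S l.1) -> word_val s = 1 ->
  forall z, foldl lact z s = z.
Proof.
have [n] := ubnP (size s); elim: n s => // n IH s ltn Ss s1 z.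
have [/not_reducedP[s1' [l [s2 def_s]]]|reds] := boolP (~~ reduced s).
  move: ltn Ss s1; rewrite def_s => ltn Ss s1.
  rewrite foldl_cat /= lactK; last by apply: Ss; rewrite mem_cat !inE eqxx !orbT.
  rewrite -foldl_cat; apply: IH; first by move: ltn; rewrite !size_cat /=; lia.
    by move=> k; rewrite mem_cat => ks; apply: Ss; rewrite mem_cat !inE; case/orP: ks => ->;
      rewrite ?orbT.
  rewrite -s1 !word_val_cat; congr (_ * _); rewrite !word_val_cons.
  by rewrite /letter_val /=; case: l.2; rewrite /= ?mulKg ?mulVKg.
case: s ltn Ss s1 reds => [//|l s] ltn Ss s1 reds.
case: bHS => _ /(_ (l :: s)); rewrite s1 => /(_ Ss); case=> //.
exact: negbNE.
Qed.

Lemma free_basis_action : exists rho : G -> X -> X,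
  [/\ forall x, S x -> rho x =1 f x, forall z, rho 1 z = z &
      forall h k, H h -> H k -> forall z, rho (h * k) z = rho k (rho h z)].
Proof.
have word h : exists s, H h -> (forall l, l \in s -> S l.1) /\ word_val s = h.
  case: (pselect (H h)) => [Hh|]; last by exists [::].
  case: bHS => defH _; move: Hh; rewrite -defH => /generated_word[s Ss sh].
  by exists s.
have [w wP] := choice word; exists (fun h z => foldl lact z (w h)).
pose iw (s : seq (letter G)) := rev [seq inv_letter l | l <- s].
have Siw s : (forall l, l \in s -> S l.1) -> forall l, l \in iw s -> S l.1.
  by move=> Ss l; rewrite mem_rev => /mapP[l' /Ss Sl' ->].
have Scat s s' : (forall l, l \in s -> S l.1) -> (forall l, l \in s' -> S l.1) ->
    forall l, l \in s ++ s' -> S l.1.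
  by move=> Ss Ss' l; rewrite mem_cat => /orP[/Ss|/Ss'].
have wact_eq s s' : (forall l, l \in s -> S l.1) -> (forall l, l \in s' -> S l.1) ->
    word_val s = word_val s' -> forall z, foldl lact z s = foldl lact z s'.
  move=> Ss Ss' e z.
  have t1 y : foldl lact y (iw s' ++ s') = y.
    apply: wact_trivial; first by apply: Scat => //; apply: Siw.
    by rewrite word_val_cat word_val_inv mulVg.
  have t2 y : foldl lact y (s ++ iw s') = y.
    apply: wact_trivial; first by apply: Scat => //; apply: Siw.
    by rewrite word_val_cat word_val_inv e mulgV.
  by rewrite -[LHS]t1 foldl_cat -(foldl_cat _ _ s) t2.
have sH : is_subgroup H by case: bHS => <- _; apply: generated_subgroup.
have SH x : S x -> H x by case: bHS => <- _ Sx; apply: mem_generated.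
split=> [x Sx z|z|h k Hh Hk z].
  have [Sw wx] := wP x (SH x Sx).
  rewrite (wact_eq _ [:: (x, false)]) //; last by rewrite wx word_val1.
  by move=> l; rewrite inE => /eqP->.
  by have [S1 w1] := wP 1 (subgroup1 sH); apply: wact_trivial.
have [Sh wh] := wP h Hh; have [Sk wk] := wP k Hk.
have [Shk whk] := wP (h * k) (subgroupM sH Hh Hk).
rewrite -foldl_cat; apply: wact_eq => //; first exact: Scat.
by rewrite word_val_cat whk wh wk.
Qed.

End Action.

End Words.

Lemma perm_extend (T : finType) (D : {set T}) (f : T -> T) :
  {in D &, injective f} -> exists p : {perm T}, {in D, p =1 f}.
Proof.
move=> injf; pose E := [set f x | x in D]%SET.
have cE : #|(~: D)%SET| = #|(~: E)%SET|.
  by apply/eqP; rewrite -(eqn_add2l #|D|) cardsC -(card_in_imset injf) cardsC.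
(* The complements of D and E have the same size: match their enumerations. *)
pose e z := nth z (enum (~: E)%SET) (index z (enum (~: D)%SET)).
have eE z : z \notin D -> e z \notin E.
  move=> nDz; rewrite -finset.in_setC -mem_enum mem_nth // -cardE -cE cardE.
  by rewrite index_mem mem_enum finset.in_setC.
pose h z := if z \in D then f z else e z.
have injh : injective h.
  move=> y z; rewrite /h; case: ifP => Dy; case: ifP => Dz.
  - exact: injf.
  - by move=> eq_fe; move: (eE z); rewrite Dz -eq_fe imset_f // => /(_ isT).
  - by move=> eq_fe; move: (eE y); rewrite Dy eq_fe imset_f // => /(_ isT).
  have lt x : x \notin D -> (index x (enum (~: D)%SET) < size (enum (~: E)%SET))%N.
    by move=> nDx; rewrite -cardE -cE cardE index_mem mem_enum finset.in_setC.
  rewrite /e (set_nth_default z y) ?lt ?Dy // => /eqP.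
  rewrite nth_uniq ?lt ?Dy ?Dz ?enum_uniq // => /eqP.
  have iD x : x \notin D -> nth z (enum (~: D)%SET) (index x (enum (~: D)%SET)) = x.
    by move=> nDx; rewrite nth_index // mem_enum finset.in_setC.
  by move=> eq_i; rewrite -(iD y) ?Dy // eq_i iD ?Dz.
by exists (perm injh) => z Dz; rewrite permE /h Dz.
Qed.

(** Free groups are residually finite: let the letters act on the set of
    prefixes of the word, the i-th letter moving the prefix of length i - 1 to
    the one of length i.  Reducedness says that this prescribes an injective
    partial map for each generator, and such a map extends to a permutation. *)
Lemma reduced_perm (G : groupType) (s : seq (letter G)) :
  reduced s -> s <> [::] -> exists (n : nat) (p : G -> {perm 'I_n.+1}),
  \prod_(l <- s) (if l.2 then (p l.1)^-1 else p l.1) <> 1.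
Proof.
move=> reds s0; set n := size s; exists n.
pose l0 : letter G := (1, false).
pose fwd x (j : nat) := (j < n) && (nth l0 s j == (x, false)).
pose bwd x (j : nat) := (0 < j) && (nth l0 s j.-1 == (x, true)).
have noturn j x e : (j.+1 < n)%N -> nth l0 s j = (x, e) -> nth l0 s j.+1 = (x, ~~ e) -> False.
  move=> ltj ej ej1; move/(sortedP l0)/(_ j ltj): reds.
  by rewrite ej ej1 /= eqxx; case: (e).
have [p pP] : exists p : G -> {perm 'I_n.+1}, forall x (j k : 'I_n.+1),
    ((fwd x j && (k == j.+1 :> nat)) || (bwd x j && (j == k.+1 :> nat))) -> p x j = k.
  suff /choice[p pP] : forall x, exists px : {perm 'I_n.+1}, forall (j k : 'I_n.+1),
    ((fwd x j && (k == j.+1 :> nat)) || (bwd x j && (j == k.+1 :> nat))) -> px j = k by exists p.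
  move=> x.
  pose f (j : 'I_n.+1) : 'I_n.+1 := if fwd x j then inord j.+1 else inord j.-1.
  pose D := [set j : 'I_n.+1 | fwd x j || bwd x j]%SET.
  have excl j : fwd x j -> bwd x j -> False.
    case: j => [//|j] /andP[lt /eqP e1] /andP[_ /eqP e2]; exact: noturn lt e2 e1.
  have fF j : fwd x j -> (j < n)%N by case/andP.
  have fB j : bwd x j -> (0 < j)%N by case/andP.
  have fv (j : 'I_n.+1) : f j = (if fwd x j then j.+1 else j.-1) :> nat.
    by rewrite /f; case: ifP => [/fF ltj|_]; rewrite inordK //; have := ltn_ord j; lia.
  have clash (j k : nat) : fwd x j -> bwd x k -> j.+1 = k.-1 -> False.
    move=> /andP[lj /eqP ej] /andP[k0 /eqP ek] jk; rewrite -jk in ek.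
    case: (ltnP j.+1 n) => ltn; first exact: noturn ltn ej ek.
    by move: ek; rewrite nth_default.
  have injf : {in D &, injective f}.
    move=> j k; rewrite !inE => Dj Dk /(congr1 val); rewrite /= !fv => fjk.
    apply: val_inj => /=; move: Dj Dk fjk.
    case: ifP => /= [fj _|_ bj]; case: ifP => /= [fk _|_ bk].
    - by case.
    - by move/(clash _ _ fj bk).
    - by move/esym/(clash _ _ fk bj).
    - by have := fB _ bj; have := fB _ bk; lia.
  have [px pxP] := perm_extend injf; exists px => j k jk; rewrite pxP; last first.
    by rewrite inE; case/orP: jk => /andP[-> _] //; rewrite orbT.
  apply: val_inj; rewrite /= fv; case/orP: jk => /andP[dj /eqP jk].
    by rewrite dj jk.
  by case: ifP => [/excl/(_ dj)//|_]; rewrite jk.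
exists p => prod1.
suff walk m : (m <= n)%N ->
    (\prod_(l <- take m s) (if l.2 then (p l.1)^-1 else p l.1)) ord0 = inord m.
  have := walk n (leqnn n); rewrite take_size prod1 perm1 => /(congr1 val).
  by rewrite /= inordK // => n0; apply: s0; apply: size0nil.
elim: m => [|m IH] lem.
  by rewrite take0 big_nil perm1; apply: val_inj; rewrite /= inordK.
rewrite (take_nth l0) // -cats1 big_cat big_seq1 permM /= IH ?(ltnW lem) //.
have im : (inord m : 'I_n.+1) = m :> nat by rewrite (@inordK n) // ltnS ltnW.
have im1 : (inord m.+1 : 'I_n.+1) = m.+1 :> nat by rewrite (@inordK n).
case el: (nth l0 s m) => [x []] /=; last first.
  by apply: pP; rewrite im im1 /fwd lem el !eqxx.
apply: (@perm_inj _ (p x)); rewrite permKV; apply/esym/pP.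
by rewrite im im1 /bwd /= el !eqxx orbT.
Qed.

(** * Iterated commutators and Schreier generators *)

Section IteratedCommutators.
Variable G : groupType.
Implicit Types (H : set G) (x y a c : G) (d : int) (pl : seq (G * int)).

(** [x, a, ..., a] or [x, a^-1, ..., a^-1], with |d| entries whose exponent has
    the sign of d. *)
Definition commz x a d : G :=
  iter (absz d) (fun y => [~ y, if (d < 0)%R then a^-1 else a]) x.

Definition lcomm x pl : G := foldl (fun y p => commz y p.1 p.2) x pl.

Definition powprod pl : G := \prod_(p <- pl) expgz p.1 p.2.

Definition shorter (d' d : int) : bool :=
  ((0 <= d') && (d' <= d) || (d <= d') && (d' <= 0))%R.

Definition below pl' pl : bool :=
  all2 (fun p' p => (p'.1 == p.1) && shorter p'.2 p.2) pl' pl.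

Lemma below_cat s1 s2 s1' s2' :
  below s1 s2 -> below s1' s2' -> below (s1 ++ s1') (s2 ++ s2').
Proof.
by elim: s1 s2 => [|p s1 IH] [|q s2] //= /andP[-> le1] /(IH _ le1).
Qed.

Lemma size_below s1 s2 : below s1 s2 -> size s1 = size s2.
Proof. by rewrite /below all2E => /andP[/eqP]. Qed.

Lemma conjg_commg x c : x ^ c = x * [~ x, c].
Proof. by rewrite commgEl mulVKg. Qed.

Lemma commgM x y z : [~ x, y * z] = [~ x, z] * [~ x, y] ^ z.
Proof. by rewrite !commgEl conjMg conjVg -mulgA mulVKg conjgM. Qed.

Lemma powprod_cons p pl : powprod (p :: pl) = expgz p.1 p.2 * powprod pl.
Proof. exact: big_cons. Qed.

Lemma powprod_cat pl pl' : powprod (pl ++ pl') = powprod pl * powprod pl'.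
Proof. exact: big_cat. Qed.

(** Since x^c = x [x, c], conjugates by powers of c are products of iterated
    commutators with c. *)
Lemma conj_exp_mem H x c m : is_subgroup H ->
  (forall k, (k <= m)%N -> H (iter k (fun y => [~ y, c]) x)) -> H (x ^ (c ^+ m)).
Proof.
move=> sH; elim: m x => [|m IH] x Hx.
  by rewrite expg0 conjg1; apply: (Hx 0).
rewrite expgS conjgM (conjg_commg x c) conjMg; apply: subgroupM => //.
  by apply: IH => k ltk; apply: Hx; apply: leqW.
by apply: IH => k ltk; rewrite -iterSr; apply: Hx.
Qed.

Lemma comm_exp_mem H x c m : is_subgroup H ->
  (forall k, (0 < k <= m)%N -> H (iter k (fun y => [~ y, c]) x)) -> H [~ x, c ^+ m].
Proof.
move=> sH; elim: m => [|m IH] Hx; first by rewrite expg0 commg1; apply: subgroup1.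
rewrite expgS commgM; apply: subgroupM => //.
  by apply: IH => k /andP[k0 km]; apply: Hx; rewrite k0 leqW.
by apply: conj_exp_mem => // k km; rewrite -iterSr; apply: Hx.
Qed.

Let commz_signed x a d k : let c := if (d < 0)%R then a^-1 else a in
  (k <= absz d)%N -> exists d', [/\ shorter d' d, absz d' = k &
    iter k (fun y => [~ y, c]) x = commz x a d'].
Proof.
move=> c kd; exists (if (d < 0)%R then - k%:Z else k%:Z)%R; rewrite /shorter /commz /c.
case: ifP => d0; split; try lia.
  by rewrite abszN /=; case: k kd => [|k] // _; rewrite ifT //; lia.
by [].  
Qed.

Lemma conj_commz_mem H x a d : is_subgroup H ->
  (forall d', shorter d' d -> H (commz x a d')) -> H (x ^ expgz a d).
Proof.
move=> sH Hx; rewrite expgz_sign; apply: conj_exp_mem => // k kd.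
by have [d' [sd' _ ->]] := commz_signed x a kd; apply: Hx.
Qed.

Lemma comm_commz_mem H x a d : is_subgroup H ->
  (forall d', shorter d' d -> d' <> 0%R -> H (commz x a d')) -> H [~ x, expgz a d].
Proof.
move=> sH Hx; rewrite expgz_sign; apply: comm_exp_mem => // k /andP[k0 kd].
have [d' [sd' dk ->]] := commz_signed x a kd; apply: Hx => //.
by move=> d0; move: k0; rewrite -dk d0.
Qed.

(** One letter at a time: conjugation by the remaining letters pulls H back to a
    subgroup, to which the case of a single letter applies. *)
Lemma conj_lcomm_mem H x pl : is_subgroup H ->
  (forall pl', below pl' pl -> H (lcomm x pl')) -> H (x ^ powprod pl).
Proof.
move=> sH; elim: pl x => [|[a d] pl IH] x Hx.
  by rewrite /powprod big_nil conjg1; apply: (Hx [::]).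
rewrite powprod_cons conjgM; set g := powprod pl.
apply: (conj_commz_mem (preim_conj_subgroup g sH)) => d' sd' /=.
apply: IH => pl' lepl'; apply: (Hx ((a, d') :: pl')).
by rewrite /below /= eqxx sd'.
Qed.

(** As [conj_lcomm_mem], but x itself is not available in H: splitting
    [x, gh] = [x, h] [x, g]^h leaves only commutators of positive length. *)
Lemma comm_lcomm_mem H x pl : is_subgroup H ->
  (forall pl', below pl' pl -> has (fun p => p.2 != 0%R) pl' -> H (lcomm x pl')) ->
  H [~ x, powprod pl].
Proof.
move=> sH; elim: pl => [|[a d] pl IH] Hx.
  by rewrite /powprod big_nil commg1; apply: subgroup1.
rewrite powprod_cons commgM; apply: subgroupM => //.
  apply: IH => pl' lepl' nz; apply: (Hx ((a, 0%R) :: pl')); last by rewrite /= nz.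
  by move: lepl'; rewrite /below /= eqxx => ->; rewrite andbT /shorter; lia.
set g := powprod pl; apply: (comm_commz_mem (preim_conj_subgroup g sH)) => d' sd' d'0 /=.
apply: conj_lcomm_mem => // pl' lepl'; apply: (Hx ((a, d') :: pl')).
  by rewrite /below /= eqxx sd'.
by rewrite /=; move/eqP: d'0 => ->.
Qed.

Lemma lcomm_cat x pl pl' : lcomm x (pl ++ pl') = lcomm (lcomm x pl) pl'.
Proof. exact: foldl_cat. Qed.

Lemma commz_mem H x a d : (forall y, H y -> H [~ y, a]) ->
  (forall y, H y -> H [~ y, a^-1]) -> H x -> H (commz x a d).
Proof.
move=> Ha HaV Hx; rewrite /commz; case: ifP => _; elim: (absz d) => //= k Hk.
  exact: HaV.
exact: Ha.
Qed.

Lemma expgzSl x d : expgz x (d + 1)%R = x * expgz x d.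
Proof.
rewrite expgzS expgz_sign; case: ifP => _; last by rewrite -expgSr expgS.
by rewrite expVgn; apply/esym/commuteV/commuteX.
Qed.

End IteratedCommutators.

Section SchreierGenerators.
Variable G : groupType.
Variable A : seq G.
Implicit Types (H : set G) (x y a : G) (tau : G -> int).

Definition monomial tau : G := powprod [seq (a, tau a) | a <- A].

(** tau + d e_y, where e_y = 0 for y outside A. *)
Definition shift y (d : int) tau : G -> int :=
  fun a => if (a == y) && (y \in A) then (tau a + d)%R else tau a.

Definition schreier y tau : G := (monomial (shift y 1 tau))^-1 * (y * monomial tau).

(** For y in A, the letters of [take (index y A) A] are those before y; if tau
    vanishes on all of them then c(y, tau) = 1. *)
Definition nontrivial y tau : bool :=
  (y \notin A) || has (fun a => tau a != 0%R) (take (index y A) A).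

(** For y in A the integers p = tau y index both signs of the initial letter:
    p >= 0 stands for the initial letter y followed by p letters y, and p < 0
    for the initial letter y^-1 followed by - p - 1 letters y^-1. *)
Definition adjust y tau : G -> int :=
  fun a => if (a == y) && (tau a < 0)%R then (tau a + 1)%R else tau a.

Definition ucomm y tau : G :=
  lcomm (if (y \in A) && (tau y < 0)%R then y^-1 else y)
        [seq (a, adjust y tau a) | a <- A].

Lemma shiftNK y d tau : shift y d (shift y (- d)%R tau) = tau.
Proof.
by apply/funext => a; rewrite /shift /=; case: (_ && _) => /=; lia.
Qed.

Lemma shiftK y d tau : shift y (- d)%R (shift y d tau) = tau.
Proof.
by apply/funext => a; rewrite /shift /=; case: (_ && _) => /=; lia.
Qed.

Hypothesis uniqA : uniq A.

Let split_letter y : y \in A -> let i := index y A in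
  [/\ A = take i A ++ y :: drop i.+1 A, y \notin take i A & y \notin drop i.+1 A].
Proof.
move=> yA i; have defA : A = take i A ++ y :: drop i.+1 A.
  by rewrite -[LHS](cat_take_drop i) (drop_nth 1) ?index_mem ?nth_index.
move: uniqA; rewrite {1}defA cat_uniq /= negb_or.
by case/and3P=> _ /andP[-> _] /andP[-> _].
Qed.

Lemma below_adjust pl' y tau :
  below pl' [seq (a, adjust y tau a) | a <- A] ->
  exists tau', [/\ pl' = [seq (a, adjust y tau' a) | a <- A],
    y \in A -> (tau' y < 0)%R = (tau y < 0)%R &
    forall a, a \in A -> (absz (tau' a) <= absz (tau a))%N].
Proof.
move=> lepl'.
pose ex a := nth 0%R [seq p.2 | p <- pl'] (index a A).
have [def_pl' exP] : pl' = [seq (a, ex a) | a <- A] /\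
    forall a, a \in A -> shorter (ex a) (adjust y tau a).
  rewrite /ex; move: lepl'; elim: (A) uniqA pl' {ex} => [|a s IH] /= us [|[b e] pl'] //=.
  case/andP=> /= /andP[/eqP -> sh] le'; case/andP: us => nas us.
  have [e1 e2] := IH us pl' le'; split.
    rewrite eqxx /=; congr (_ :: _); rewrite {1}e1; apply/eq_in_map => c cs /=.
    by rewrite ifF //; apply: contraNF nas => /eqP ->.
  move=> c; rewrite inE => /orP[/eqP->|cs]; first by rewrite eqxx.
  rewrite ifF /=; first exact: e2.
  by apply: contraNF nas => /eqP ->.
exists (fun a => if (a == y) && (tau a < 0)%R then (ex a - 1)%R else ex a).
split.
- rewrite {1}def_pl'; apply/eq_in_map => a aA /=; congr (_, _).
  have := exP a aA; rewrite /adjust /shorter; case: eqP => //= _.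
  by case: (ltrP (tau a) 0%R) => ? ?; case: ifP; lia.
- move=> yA; have := exP y yA; rewrite /adjust /shorter eqxx /=.
  by case: (ltrP (tau y) 0%R); lia.
move=> a aA; have := exP a aA; rewrite /adjust /shorter; case: eqP => /= _; last lia.
by case: (ltrP (tau a) 0%R); lia.
Qed.

(** For y outside A the Schreier generator is the conjugate of y by m(tau).  For
    y in A, write m(tau) = h1 y^p h2; then c(y, tau) = [y, h1]^(y^p h2), which
    is also the inverse of [y^-1, h1]^(y^(p+1) h2).  The second form serves for
    p < 0: all the letters y then occur with exponent -1, as index coherence
    requires. *)
Lemma schreier_mem H y tau : is_subgroup H -> nontrivial y tau ->
  (forall tau', nontrivial y tau' ->
     (forall a, a \in A -> (absz (tau' a) <= absz (tau a))%N) -> H (ucomm y tau')) ->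
  H (schreier y tau).
Proof.
move=> sH nt Hu.
have [yA|nyA] := boolP (y \in A); last first.
  have -> : schreier y tau = y ^ monomial tau.
    rewrite /schreier; congr (_^-1 * _); rewrite /monomial /shift (negbTE nyA).
    by congr powprod; apply: eq_map => a; rewrite andbF.
  apply: conj_lcomm_mem => // pl' lepl'.
  have adjE tau' : [seq (a, adjust y tau' a) | a <- A] = [seq (a, tau' a) | a <- A].
    apply/eq_in_map => a aA; rewrite /adjust ifF //.
    by apply/negP => /andP[/eqP ay]; rewrite -ay aA in nyA.
  rewrite -adjE in lepl'; have [tau' [-> _ le']] := below_adjust lepl'.
  have nt' : nontrivial y tau' by rewrite /nontrivial nyA.
  by have := Hu tau' nt' le'; rewrite /ucomm (negbTE nyA).
pose A1 := take (index y A) A; pose A2 := drop (index y A).+1 A.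
have [defA nyA1 nyA2] : [/\ A = A1 ++ y :: A2, y \notin A1 & y \notin A2] :=
  split_letter yA.
pose pl1 := [seq (a, tau a) | a <- A1]; pose pl2 := [seq (a, tau a) | a <- A2].
have same (f : G -> int) (s : seq G) : y \notin s -> (forall a, a != y -> f a = tau a) ->
    [seq (a, f a) | a <- s] = [seq (a, tau a) | a <- s].
  move=> nys fE; apply/eq_in_map => a sa; rewrite fE //.
  by apply: contraNneq nys => <-.
have mapA (f : G -> int) : (forall a, a != y -> f a = tau a) ->
    [seq (a, f a) | a <- A] = pl1 ++ (y, f y) :: pl2.
  by move=> fE; rewrite defA map_cat /= !(same f).
pose x := if (tau y < 0)%R then y^-1 else y.
pose v := adjust y tau y.
have Hx : H ([~ x, powprod pl1] ^ powprod ((y, v) :: pl2)).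
  set g := powprod (_ :: _).
  apply: (comm_lcomm_mem (preim_conj_subgroup g sH)) => pl1' le1 nz1 /=.
  apply: conj_lcomm_mem => // pl2' le2; rewrite -lcomm_cat.
  have le12 : below (pl1' ++ pl2') [seq (a, adjust y tau a) | a <- A].
    rewrite mapA => [|a /negbTE ay]; last by rewrite /adjust ay.
    exact: below_cat.
  have [tau' [def' sgn' le']] := below_adjust le12.
  have nt' : nontrivial y tau'.
    rewrite /nontrivial yA /= -/A1.
    have /(congr1 (take (size A1))) : pl1' ++ pl2' =
        [seq (a, adjust y tau' a) | a <- A1] ++ (y, adjust y tau' y) ::
        [seq (a, adjust y tau' a) | a <- A2] by rewrite def' defA map_cat.
    have s1 : size pl1' = size A1 by rewrite (size_below le1) size_map.
    rewrite !take_size_cat ?size_map // => def1.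
    move: nz1; rewrite def1 has_map => /hasP[a aA1] /=; rewrite /adjust.
    case: (a =P y) => [ay|_] nza; first by rewrite -ay aA1 in nyA1.
    by apply/hasP; exists a.
  by have := Hu tau' nt' le'; rewrite /ucomm yA sgn' //= -def'.
rewrite /schreier /monomial !mapA //; last first.
  by move=> a /negbTE ay; rewrite /shift ay.
rewrite !powprod_cat !powprod_cons /= /shift eqxx yA /=.
move: Hx; rewrite powprod_cons /= /x /v /adjust eqxx /=.
set h1 := powprod pl1; set h2 := powprod pl2.
case: ifP => _ Hx.
  suff <- : ([~ y^-1, h1] ^ (expgz y (tau y + 1) * h2))^-1 =
     (h1 * (expgz y (tau y + 1) * h2))^-1 * (y * (h1 * (expgz y (tau y) * h2))).
    exact: subgroupV.
  have -> : expgz y (tau y) = y^-1 * expgz y (tau y + 1) by rewrite expgzSl mulKg.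
  set q := expgz _ _.
  by rewrite -conjVg invgR /commg /conjg !invgM invgK !mulgA.
rewrite expgzSl.
suff <- : [~ y, h1] ^ (expgz y (tau y) * h2) =
     (h1 * (y * expgz y (tau y) * h2))^-1 * (y * (h1 * (expgz y (tau y) * h2))) by [].
by rewrite /commg /conjg !invgM !mulgA.
Qed.

Lemma powprod_zero (s : seq G) tau :
  (forall a, a \in s -> tau a = 0%R) -> powprod [seq (a, tau a) | a <- s] = 1.
Proof.
elim: s => [|a s IH] z; first exact: big_nil.
rewrite /= powprod_cons IH => [|b sb]; last by apply: z; rewrite inE sb orbT.
by rewrite /= z ?inE ?eqxx // mulg1.
Qed.

Lemma eq_nontrivial y tau tau' :
  {in A, tau =1 tau'} -> nontrivial y tau = nontrivial y tau'.
Proof.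
move=> e; rewrite /nontrivial; congr (_ || _); apply: eq_in_has => a /mem_take aA.
by rewrite e.
Qed.

Lemma eq_ucomm y tau tau' : {in A, tau =1 tau'} -> ucomm y tau = ucomm y tau'.
Proof.
move=> e; rewrite /ucomm; congr lcomm; last first.
  by apply/eq_in_map => a aA; rewrite /adjust e.
by case: (boolP (y \in A)) => //= yA; rewrite e.
Qed.

Lemma schreier_trivial y tau : ~~ nontrivial y tau -> schreier y tau = 1.
Proof.
rewrite negb_or negbK => /andP[yA /hasPn z].
pose A1 := take (index y A) A; pose A2 := drop (index y A).+1 A.
have [defA nyA1 nyA2] : [/\ A = A1 ++ y :: A2, y \notin A1 & y \notin A2] :=
  split_letter yA.
have same (s : seq G) : y \notin s ->
    [seq (a, shift y 1 tau a) | a <- s] = [seq (a, tau a) | a <- s].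
  move=> nys; apply/eq_in_map => a sa; rewrite /shift ifF //.
  by apply: contraNF nys => /andP[/eqP <-].
rewrite /schreier /monomial {1 2}defA !map_cat !powprod_cat /= !powprod_cons /= !same //.
have -> : powprod [seq (a, tau a) | a <- A1] = 1.
  by apply: powprod_zero => a /z /negPn/eqP.
by rewrite /shift eqxx yA /= expgzSl !mul1g -(mulgA y) mulVg.
Qed.

(** Schreier's argument: the cosets H m(tau)^-1 are permuted by right
    multiplication by the generators. *)
Lemma schreier_transversal (S H : set G) : is_subgroup H ->
  (forall y tau, S y -> nontrivial y tau -> H (schreier y tau)) ->
  forall r, subgroup_generated S r -> exists tau, H (r * monomial tau).
Proof.
move=> sH Hc r /generated_word[s Ss <-].
have {}Hc y tau : S y -> H (schreier y tau).
  move=> Sy; have [/Hc|/schreier_trivial ->] := boolP (nontrivial y tau); first exact.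
  exact: subgroup1.
elim/last_ind: s Ss => [|s [y e] IH] Ss.
  exists (fun=> 0%R); rewrite /monomial powprod_zero // word_val0 mulg1.
  exact: subgroup1.
have Sy : S y by apply: (Ss (y, e)); rewrite mem_rcons inE eqxx.
have [|tau Htau] := IH; first by move=> l ls; apply: Ss; rewrite mem_rcons inE ls orbT.
rewrite -cats1 word_val_cat word_val1 /letter_val /=; case: e {Ss} => /=.
  exists (shift y 1 tau).
  have := subgroupM sH Htau (subgroupV sH (Hc y tau Sy)).
  by rewrite /schreier !invgM invgK !mulgA mulgK.
exists (shift y (-1) tau).
have := subgroupM sH Htau (Hc y (shift y (-1) tau) Sy).
by rewrite /schreier shiftNK !mulgA mulgK.
Qed.

Lemma ucomm_mem (S R N : set G) : is_subgroup R -> S `<=` R ->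
  [set` A] `<=` R -> is_subgroup N ->
  N `<=` R -> (forall y, S y -> y \notin A -> N y) ->
  (forall r r', R r -> R r' -> N [~ r, r']) ->
  forall y tau, S y -> nontrivial y tau -> N (ucomm y tau).
Proof.
move=> sR SR AR sN NR SN RN y tau Sy nt.
pose x := if (y \in A) && (tau y < 0)%R then y^-1 else y.
have RAa (s : seq G) f : {subset s <= A} -> forall p, p \in [seq (a, f a : int) | a <- s] -> R p.1.
  by move=> sA p /mapP[a /sA/AR Ra ->].
have inN pl z : (forall p, p \in pl -> R p.1) -> N z -> N (lcomm z pl).
  elim: pl z => [|p pl IH] z //= Rpl Nz; apply: IH.
    by move=> q ql; apply: Rpl; rewrite inE ql orbT.
  have Rp : R p.1 by apply: Rpl; rewrite inE eqxx.
  by apply: commz_mem => // w /NR Rw; apply: RN => //; apply: subgroupV.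
have inN' pl z : (forall p, p \in pl -> R p.1) -> has (fun p => p.2 != 0%R) pl ->
    R z -> N (lcomm z pl).
  elim: pl z => [|[a d] pl IH] z //= Rpl nz Rz.
  have Rpl' q : q \in pl -> R q.1 by move=> ql; apply: Rpl; rewrite inE ql orbT.
  have Ra : R a by apply: (Rpl (a, d)); rewrite inE eqxx.
  have [d0|d0] := eqVneq d 0%R.
    by move: nz; rewrite d0 eqxx /= /commz /= => nz; apply: IH.
  apply: inN => //; rewrite /commz; case: (absz d) (absz_eq0 d) => [|k _].
    by rewrite eqxx (negbTE d0).
  set c := if _ then _ else _.
  have Rc : R c by rewrite /c; case: ifP => _ //; apply: subgroupV.
  have Rk : R (iter k (fun y => [~ y, c]) z).
    by elim: k => //= k Rk; apply: subgroup_comm.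
  by rewrite iterS; apply: RN.
rewrite /ucomm -/x; have [yA|nyA] := boolP (y \in A); last first.
  by apply: inN; [exact: RAa | rewrite /x (negbTE nyA); apply: SN].
apply: inN'; first exact: RAa.
  move: nt; rewrite /nontrivial yA /= => /hasP[a a1 nz]; rewrite has_map.
  apply/hasP; exists a; first exact: mem_take a1.
  rewrite /= /adjust; case: (a =P y) => //= ay.
  move: a1; rewrite ay => y1.
  by move: uniqA; rewrite -{1}(cat_take_drop (index y A) A) cat_uniq (drop_nth 1) ?index_mem //
    nth_index //= y1 /= andbF.
rewrite /x; case: ifP => _; last exact: SR.
by apply: subgroupV => //; exact: SR.
Qed.

End SchreierGenerators.

(** * Homomorphisms with prescribed values on the Schreier generators *)

(** R acts on Q x Z^A by (q, tau) y = (q s(y, tau - e_y), tau - e_y).  As s is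
    trivial on the edges that the monomials follow, m(tau)^-1 takes (1, 0) to
    (1, tau), so that c(y, tau) takes (1, 0) to (s(y, tau), 0).  The stabiliser
    K of the second coordinate then maps to Q by its effect on (1, 0). *)
Section Cocycle.
Variables (G : groupType) (A : seq G) (uniqA : uniq A).
Variables (R S : set G) (bRS : free_basis R S) (AS : [set` A] `<=` S).
Variables (Q : groupType) (s : G -> (G -> int) -> Q).
Hypothesis s_trivial : forall y tau, ~~ nontrivial A y tau -> s y tau = 1.

Let X : Type := (Q * (G -> int))%type.

Let sR : is_subgroup R.
Proof. by case: bRS => <- _; apply: generated_subgroup. Qed.

Let SR : S `<=` R.
Proof. by case: bRS => <- _; apply: mem_generated. Qed.

Lemma cocycle_hom : exists (K : set G) (phi : G -> Q),
  [/\ is_subgroup K,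
      forall k k', K k -> K k' -> phi (k * k') = phi k * phi k',
      forall r r', R r -> R r' -> K [~ r, r'],
      forall y, S y -> y \notin A -> K y &
      forall y tau, S y -> (forall a, a \notin A -> tau a = 0%R) ->
        K (schreier A y tau) /\ phi (schreier A y tau) = s y tau] /\ K `<=` R.
Proof.
pose f y (z : X) : X :=
  (z.1 * s y (shift A y (-1) z.2), shift A y (-1) z.2).
pose g y (z : X) : X := (z.1 * (s y z.2)^-1, shift A y 1 z.2).
have [] := @free_basis_action G S R X f g bRS.
- by move=> y _ [q tau]; rewrite /f /g /= mulgK shiftNK.
- by move=> y _ [q tau]; rewrite /f /g /= shiftK mulgVK.
move=> rho [rhoS rho1 rhoM].
have sgenR : subgroup_generated S = R by case: bRS.
(* Every r in R shifts the second factor by a constant and multiplies the first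
   one on the right, by an amount that depends on the second coordinate. *)
pose tr (r : G) := exists (ga : (G -> int) -> Q) (d : G -> int), forall q tau,
  rho r (q, tau) = (q * ga tau, (fun a => (tau a + d a)%R)).
have trR r : R r -> tr r.
  rewrite -sgenR => Sr.
  suff : (R `&` tr) r by case.
  apply: (generated_sub _ _ Sr) => [|y Sy]; last first.
    split; first exact: SR.
    exists (fun tau => s y (shift A y (-1) tau)).
    exists (fun a => if (a == y) && (y \in A) then (-1)%R else 0%R) => q tau.
    rewrite rhoS // /f /=; congr (_, _); apply/funext => a; rewrite /shift.
    by case: (_ && _) => //; lia.
  apply/is_subgroupP; split.
    split; first exact: subgroup1.
    exists (fun=> 1), (fun=> 0%R) => q tau; rewrite rho1 mulg1; congr (_, _).
    by apply/funext => a; lia.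
  move=> x y [Rx [gx [dx ex]]] [Ry [gy [dy ey]]].
  split; first exact: subgroupM sR Rx (subgroupV sR Ry).
  have eyV q tau : rho y^-1 (q, tau) =
      (q * (gy (fun a => tau a - dy a)%R)^-1, (fun a => tau a - dy a)%R).
    rewrite -[RHS]rho1 -(mulgV y) rhoM //; last exact: subgroupV.
    rewrite ey mulgVK; congr (rho _ (_, _)); apply/funext => a; lia.
  exists (fun tau => gx tau * (gy (fun a => tau a + dx a - dy a)%R)^-1).
  exists (fun a => dx a - dy a)%R => q tau.
  rewrite rhoM //; last exact: subgroupV.
  rewrite ex eyV mulgA; congr (_, _); apply/funext => a; lia.
pose K := [set r | R r /\ forall q tau, (rho r (q, tau)).2 = tau].
pose phi r := (rho r (1, fun=> 0%R)).1.
have phiE k q : K k -> rho k (q, fun=> 0%R) = (q * phi k, fun=> 0%R).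
  move=> [Rk Kk]; rewrite /phi; have [ga [d e]] := trR k Rk.
  move: (Kk q (fun=> 0%R)); rewrite !e /= => ->.
  by rewrite mul1g.
have KR : K `<=` R by move=> k [].
have KE r : R r -> forall q tau, (forall a, (rho r (q, tau)).2 a = tau a) -> K r.
  move=> Rr q tau; have [ga [d e]] := trR r Rr; rewrite e /= => d0; split=> // q' tau'.
  by rewrite e; apply/funext => a /=; have := d0 a; lia.
exists K, phi; split=> //; split=> //.
- apply/is_subgroupP; split.
    by apply: (KE _ (subgroup1 sR) 1 (fun=> 0%R)) => a; rewrite rho1.
  move=> x y [Rx Kx] [Ry Ky].
  have RV := subgroupV sR Ry.
  apply: (KE _ (subgroupM sR Rx RV) 1 (fun=> 0%R)) => a.
  rewrite rhoM //; case e: (rho x _) => [q tau].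
  have := Kx 1 (fun=> 0%R); rewrite e /= => ->.
  have := Ky (rho y^-1 (q, fun=> 0%R)).1 (rho y^-1 (q, fun=> 0%R)).2.
  by rewrite -surjective_pairing -rhoM // mulVg rho1 => <-.
- move=> k k' Kk Kk'; rewrite /phi rhoM; [|exact: KR|exact: KR].
  by rewrite phiE // phiE //= mul1g.
- move=> r r' Rr Rr'.
  have Rc : R [~ r, r'] by apply: subgroup_comm.
  have [ga [d e]] := trR r Rr; have [ga' [d' e']] := trR r' Rr'.
  have [gc [dc ec]] := trR _ Rc.
  have Rrr : R (r' * r) by apply: subgroupM.
  have : rho (r' * r * [~ r, r']) (1, fun=> 0%R) = rho (r * r') (1, fun=> 0%R).
    by rewrite (commgC r r').
  rewrite (rhoM _ _ Rrr Rc) (rhoM _ _ Rr' Rr) (rhoM _ _ Rr Rr') e' !e e' ec => -[_ eqd].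
  apply: (KE _ Rc 1 (fun=> 0%R)) => a; rewrite ec /=.
  by have := congr1 (fun tau => tau a) eqd; lia.
- move=> y Sy nyA; apply: (KE _ (SR Sy) 1 (fun=> 0%R)) => a.
  by rewrite rhoS //= /shift (negbTE nyA) andbF.
have AR a : a \in A -> R a by move=> aA; apply/SR/AS.
have shift_neq y d tau a : a != y -> shift A y d tau a = tau a.
  by rewrite /shift => /negbTE ->.
(* On these letters no earlier exponent is left, so the edges have value 1. *)
have expn_act A1 A2 a q tau m : A = A1 ++ a :: A2 -> (forall b, b \in A1 -> tau b = 0%R) ->
    rho (a ^+ m) (q, tau) = (q, shift A a (- m%:Z) tau).
  move=> defA z; have aA : a \in A by rewrite defA mem_cat inE eqxx orbT.
  have naA1 : a \notin A1 by move: uniqA; rewrite defA cat_uniq /= negb_or; case/and3P=> _ /andP[].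
  elim: m => [|m IH]; first by rewrite rho1; congr (_, _); apply/funext => b;
    rewrite /shift; case: (_ && _); lia.
  have Ram : R (a ^+ m) by apply: (subgroup_expgz m sR); apply: AR.
  rewrite expgSr rhoM //; last exact: AR.
  rewrite IH rhoS; last exact: AS.
  rewrite /f /= s_trivial ?mulg1.
    congr (_, _); apply/funext => b; rewrite /shift /=.
    by case: (_ && _) => /=; lia.
  rewrite /nontrivial aA /=; apply/hasPn => b.
  rewrite {1}defA index_cat (negbTE naA1) /= eqxx addn0 defA take_size_cat // => bA1.
  have ba : b != a by apply: contraNneq naA1 => <-.
  by rewrite -defA !shift_neq // z.
have expz_act A1 A2 a q tau d : A = A1 ++ a :: A2 -> (forall b, b \in A1 -> tau b = 0%R) ->
    rho (expgz a d) (q, tau) = (q, shift A a (- d) tau).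
  move=> defA z; case: d => m; first exact: (expn_act A1 A2).
  have aA : a \in A by rewrite defA mem_cat inE eqxx orbT.
  have Ram : R (a ^+ m.+1) by apply: (subgroup_expgz m.+1 sR); apply: AR.
  have naA1 : a \notin A1 by move: uniqA; rewrite defA cat_uniq /= negb_or; case/and3P=> _ /andP[].
  rewrite /expgz -[RHS]rho1 -(mulgV (a ^+ m.+1)) rhoM //; last exact: subgroupV.
  rewrite (expn_act A1 A2) //; last first.
    move=> b bA1; rewrite shift_neq ?z //.
    by apply: contraNneq naA1 => <-.
  by rewrite NegzE opprK shiftK.
have zero_act A2 : forall A1 q tau, A = A1 ++ A2 -> (forall a, a \in A1 -> tau a = 0%R) ->
    (forall a, a \notin A -> tau a = 0%R) ->
    rho (powprod [seq (a, tau a) | a <- A2]) (q, tau) = (q, fun=> 0%R).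
  elim: A2 => [|a A2 IH] A1 q tau defA z1 z.
    rewrite /powprod big_nil rho1; congr (_, _); apply/funext => a.
    have [aA|/z //] := boolP (a \in A).
    by apply: z1; rewrite defA cats0 in aA.
  have aA : a \in A by rewrite defA mem_cat inE eqxx orbT.
  have naA2 : a \notin A2.
    by move: uniqA; rewrite defA cat_uniq /= negb_or; case/and3P=> _ _ /andP[].
  have sA2 : {subset A2 <= A} by move=> b bA2; rewrite defA mem_cat inE bA2 !orbT.
  rewrite /= powprod_cons rhoM /=; [|by apply: subgroup_expgz => //; apply: AR|]; last first.
    rewrite /powprod big_map big_seq; elim/big_ind: _.
    - exact: subgroup1.
    - by move=> ? ?; apply: subgroupM.
    - by move=> b /sA2/AR Rb; apply: subgroup_expgz.
  rewrite (expz_act A1 A2) //.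
  set tau' := shift A a _ tau.
  have -> : [seq (b, tau b) | b <- A2] = [seq (b, tau' b) | b <- A2].
    apply/eq_in_map => b bA2; rewrite /tau' shift_neq //.
    by apply: contraNneq naA2 => <-.
  apply: (IH (A1 ++ [:: a])); first by rewrite -catA.
    move=> b; rewrite mem_cat inE => /orP[bA1|/eqP ->].
      have [->|ba] := eqVneq b a; last by rewrite /tau' shift_neq ?z1.
      by rewrite /tau' /shift eqxx aA subrr.
    by rewrite /tau' /shift eqxx aA subrr.
  move=> b nbA; rewrite /tau' shift_neq ?z //.
  by apply: contraNneq nbA => ->.
move=> y tau Sy z.
have Rm tau' : R (monomial A tau').
  rewrite /monomial /powprod big_map big_seq; elim/big_ind: _.
  - exact: subgroup1.
  - by move=> ? ?; apply: subgroupM.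
  - by move=> b /AR Rb; apply: subgroup_expgz.
have z' a : a \notin A -> shift A y 1 tau a = 0%R.
  move=> naA; rewrite /shift; case: eqP => [<-|_] /=; last exact: z.
  by rewrite (negbTE naA) z.
have Ry := SR Sy.
have Rym : R (y * monomial A tau) by apply: subgroupM.
have e : rho (schreier A y tau) (1, fun=> 0%R) = (s y tau, fun=> 0%R).
  rewrite /schreier rhoM //; last exact: subgroupV.
  rewrite -(zero_act A [::] 1 (shift A y 1 tau)) //.
  rewrite -(rhoM _ _ (Rm _) (subgroupV sR (Rm _))) mulgV.
  rewrite rho1 rhoM // (rhoS _ Sy) /f /= shiftK mul1g.
  exact: (zero_act A [::]).
split; last by rewrite /phi e.
apply: (KE _ _ 1 (fun=> 0%R)) => [|a]; last by rewrite e.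
by apply: subgroupM => //; apply: subgroupV.
Qed.

End Cocycle.

(** * Freeness by counting homomorphisms to a finite group *)

Section Freeness.

Definition box (M k : nat) : seq (seq int) :=
  iter k (fun L => [seq (i%:Z - M%:Z)%R :: v | i <- iota 0 M.*2.+1, v <- L]) [:: [::]].

Lemma mem_box M k v :
  (v \in box M k) = (size v == k) && all (fun i => absz i <= M)%N v.
Proof.
elim: k v => [|k IH] v; first by rewrite inE; case: v.
rewrite /box iterS -/(box M k); case: v => [|i v].
  by apply/negbTE/allpairsP => -[[j w] []].
apply/allpairsP/andP => [[[j w] [jM wk [-> ->]]]|[/eqP[sz] /andP[iM vM]]].
  move: wk; rewrite IH /= => /andP[/eqP -> ->]; split; rewrite ?eqxx // andbT.
  by move: jM; rewrite mem_iota /=; lia.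
exists (absz (i + M%:Z)%R, v); split.
- by rewrite mem_iota /=; lia.
- by rewrite IH sz eqxx; exact: vM.
by congr (_ :: _) => /=; move: iM => /=; lia.
Qed.

Variables (G : groupType) (A : seq G) (uniqA : uniq A).
Variables (R S : set G) (bRS : free_basis R S) (AS : [set` A] `<=` S).

Let vec (tau : G -> int) : seq int := [seq tau a | a <- A].
Let unvec (v : seq int) : G -> int := fun a => nth 0%R v (index a A).

Let unvecK tau : {in A, unvec (vec tau) =1 tau}.
Proof. by move=> a aA; rewrite /unvec /vec (nth_map a) ?index_mem ?nth_index. Qed.

Let vecK v : size v = size A -> vec (unvec v) = v.
Proof.
move=> sv; apply: (@eq_from_nth _ 0%R); rewrite size_map // => i iA.
by rewrite (nth_map 1) // /unvec index_uniq.
Qed.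

Lemma ucomm_free (sw : seq (letter G)) :
  (forall l, l \in sw -> exists y tau,
     [/\ S y, nontrivial A y tau & l.1 = ucomm A y tau]) ->
  reduced sw -> sw <> [::] -> word_val sw <> 1.
Proof.
move=> swU redsw sw0 sw1; have [n [p]] := reduced_perm redsw sw0; apply.
pose Q : finGroupType := {perm 'I_n.+1}.
have /choice[idx idxP] : forall z, exists yv : G * (G -> int), z \in [seq l.1 | l <- sw] ->
    [/\ S yv.1, nontrivial A yv.1 yv.2 & z = ucomm A yv.1 yv.2].
  move=> z; have [/mapP[l /swU [y [tau H]] ->]|] := boolP (z \in [seq l.1 | l <- sw]).
    by exists (y, tau).
  by exists (1, fun=> 0%R).
pose Y := [seq (idx l.1).1 | l <- sw].
have YS y : y \in Y -> S y.
  by case/mapP=> l ls ->; have [] := idxP l.1 (map_f _ ls).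
(* J consists of the pairs (y, tau) with y among the initial letters that occur
   and all the |tau a| bounded by M, so it contains the indices that occur and
   is closed under decreasing |tau|. *)
pose M := \max_(l <- sw) \max_(a <- A) absz ((idx l.1).2 a).
pose P := [seq yv <- [seq (y, v) | y <- Y, v <- box M (size A)] |
             nontrivial A yv.1 (unvec yv.2)].
have PE y v : ((y, v) \in P) = [&& nontrivial A y (unvec v), y \in Y & v \in box M (size A)].
  rewrite mem_filter /=; congr (_ && _); apply/allpairsP/andP => [[[y' v'] [? ? [-> ->]]] //|[]].
  by exists (y, v).
pose J : finType := seq_sub P.
pose s (f : {ffun J -> Q}) (y : G) (tau : G -> int) : Q :=
  if insub (y, vec tau) is Some j then f j else 1.
pose u (j : J) : G := ucomm A (val j).1 (unvec (val j).2).
have nt_unvec y tau : nontrivial A y (unvec (vec tau)) = nontrivial A y tau.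
  exact/eq_nontrivial/unvecK.
have /choice[Kphi KphiP] : forall f : {ffun J -> Q}, exists Kphi : set G * (G -> Q),
  [/\ is_subgroup Kphi.1,
      forall k k', Kphi.1 k -> Kphi.1 k' -> Kphi.2 (k * k') = Kphi.2 k * Kphi.2 k',
      forall j, Kphi.1 (u j) &
      forall j : J, Kphi.1 (schreier A (val j).1 (unvec (val j).2)) /\
         Kphi.2 (schreier A (val j).1 (unvec (val j).2)) = f j].
  move=> f; have [|K [phi [[sK phiM KR KS Kc] KR']]] := @cocycle_hom G A uniqA R S bRS AS Q (s f).
    move=> y tau ntt; rewrite /s; case: insubP => // j jP _.
    by move: jP; rewrite PE nt_unvec (negbTE ntt).
  have sR : is_subgroup R by case: bRS => <- _; apply: generated_subgroup.
  have SR : S `<=` R by case: bRS => <- _; apply: mem_generated.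
  exists (K, phi); split=> //= -[[y v] /= jP].
    rewrite /u /=.
    have := jP; rewrite PE => /and3P[nt yY _].
    apply: (@ucomm_mem G A uniqA S R K) => //; last exact: YS.
    exact: (subset_trans AS SR).
  have := jP; rewrite PE mem_box => /and4P[nt yY /eqP sv _].
  have [|Kc1 ->] := Kc y (unvec v) (YS _ yY).
    by move=> a naA; rewrite /unvec nth_default // sv leqNgt index_mem.
  split=> //; rewrite /s vecK //; case: insubP => [j _ ej|]; last by rewrite jP.
  by congr (f _); apply: val_inj.
have phi1 f : (Kphi f).2 1 = 1.
  have [sK phiM _ _] := KphiP f; have K1 := subgroup1 sK.
  by apply: (mulgI ((Kphi f).2 1)); rewrite -phiM // !mulg1.
have phiV f k : (Kphi f).1 k -> (Kphi f).2 k^-1 = ((Kphi f).2 k)^-1.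
  have [sK phiM _ _] := KphiP f => Kk; have KV := subgroupV sK Kk.
  by apply: (mulgI ((Kphi f).2 k)); rewrite -phiM // !mulgV phi1.
pose Phi (f : {ffun J -> Q}) : {ffun J -> Q} := [ffun j => (Kphi f).2 (u j)].
(* The values of a homomorphism at the u's determine those at the Schreier
   generators, that is, the family f it was made from. *)
have injPhi : injective Phi.
  move=> f f' eqPhi; apply/ffunP => j.
  have [sK phiM Ku Kc] := KphiP f; have [sK' phiM' Ku' Kc'] := KphiP f'.
  pose H := [set k | [/\ (Kphi f).1 k, (Kphi f').1 k & (Kphi f).2 k = (Kphi f').2 k]].
  suff : H (schreier A (val j).1 (unvec (val j).2)).
    by case=> _ _; rewrite (Kc j).2 (Kc' j).2.
  have sH : is_subgroup H.
    apply/is_subgroupP; split=> [|x y [Kx Kx' exy] [Ky Ky' ey]].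
      by split; rewrite ?(phi1 f) ?(phi1 f') //; apply: subgroup1.
    have [KV KV'] := (subgroupV sK Ky, subgroupV sK' Ky').
    by split; [exact: subgroupM | exact: subgroupM |];
      rewrite phiM ?phiM' ?phiV // exy ey.
  have := valP j; case e: (val j) => [y v] /=; rewrite PE mem_box => /and4P[nt yY /eqP sv vM].
  apply: (schreier_mem uniqA sH nt) => tau nttau letau.
  have jP : (y, vec tau) \in P.
    rewrite PE nt_unvec nttau yY mem_box size_map eqxx /=.
    apply/allP => i /mapP[a aA ->]; apply: leq_trans (letau a aA) _.
    by apply: (allP vM); rewrite /unvec mem_nth // sv index_mem.
  have -> : ucomm A y tau = u (SeqSub jP).
    by rewrite /u /=; apply: eq_ucomm => a aA; rewrite unvecK.
  split; [exact: Ku | exact: Ku' |].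
  by have /ffunP/(_ (SeqSub jP)) := eqPhi; rewrite !ffunE.
(* An injective self-map of a finite set is onto. *)
have [f fP] : exists f, forall l, l \in sw -> (Kphi f).1 l.1 /\ (Kphi f).2 l.1 = p l.1.
  pose pu : {ffun J -> Q} := [ffun j => p (u j)].
  have /codomP[f fP] := injF_onto injPhi pu.
  exists f => l ls; have [Sy ntl def_l] := idxP l.1 (map_f _ ls).
  have jP : ((idx l.1).1, vec (idx l.1).2) \in P.
    rewrite PE nt_unvec ntl mem_box size_map eqxx /=; apply/andP; split.
      by apply/mapP; exists l.
    apply/allP => i /mapP[a aA ->].
    have le1 := leq_bigmax_seq (P := xpredT) (F := fun a => absz ((idx l.1).2 a)) a aA isT.
    have le2 := leq_bigmax_seq (P := xpredT)
      (F := fun l : letter G => \max_(a <- A) absz ((idx l.1).2 a)) l ls isT.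
    exact: leq_trans le1 le2.
  have [_ _ Ku _] := KphiP f.
  have def_u : l.1 = u (SeqSub jP).
    by rewrite {1}def_l /u /=; apply: eq_ucomm => a aA; rewrite unvecK.
  have /ffunP/(_ (SeqSub jP)) := fP; rewrite !ffunE -def_u => <-.
  by split=> //; rewrite def_u; apply: Ku.
have [sK phiM Ku _] := KphiP f.
have : forall s', {subset s' <= sw} -> (Kphi f).1 (word_val s') /\
    (Kphi f).2 (word_val s') = \prod_(l <- s') (if l.2 then (p l.1)^-1 else p l.1).
  elim=> [|[x e] s' IH] ss'.
    by rewrite word_val0 big_nil phi1; split=> //; apply: subgroup1.
  have [Ks' es'] : _ := IH (fun l ls => ss' l (mem_behead (s := _ :: _) ls)).
  have [Kx ex] := fP (x, e) (ss' _ (mem_head _ _)).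
  rewrite word_val_cons big_cons /letter_val /= -es'; case: e {ss'} Kx ex => /= Kx ex.
    have KxV := subgroupV sK Kx.
    by split; [apply: subgroupM | rewrite phiM ?phiV ?ex].
  by split; [apply: subgroupM | rewrite phiM ?ex].
case/(_ sw (fun=> id)) => _ <-.
by rewrite sw1 phi1.
Qed.

End Freeness.

(** * The U-construction indexed by exponent vectors *)

Section Expand.
Variable G : groupType.
Implicit Types (pl : seq (G * int)) (L : seq (letter G)).

(** The word a_1^alpha_1, ..., a_q^alpha_q with the signed multiplicities [pl]. *)
Definition expand pl : seq (letter G) :=
  flatten [seq nseq (absz p.2) (p.1, (p.2 < 0)%R) | p <- pl].

Lemma lcomm_expand x pl :
  lcomm x pl = foldl (@commg G) x [seq letter_val l | l <- expand pl].
Proof.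
elim: pl x => [|[a d] pl IH] x //=.
rewrite map_cat foldl_cat -IH; congr lcomm; rewrite map_nseq /commz /letter_val /=.
by elim: (absz d) x => //= k IHk x; rewrite -IHk -iterSr.
Qed.

Lemma mem_expand l pl : l \in expand pl ->
  exists p, [/\ p \in pl, p.2 != 0%R & l = (p.1, (p.2 < 0)%R)].
Proof.
case/flatten_mapP => p ppl; rewrite mem_nseq => /andP[p0 /eqP ->].
by exists p; split=> //; rewrite -absz_gt0.
Qed.

Lemma expand_cat pl1 pl2 : expand (pl1 ++ pl2) = expand pl1 ++ expand pl2.
Proof. by rewrite /expand map_cat flatten_cat. Qed.

Lemma expand_nil pl p : expand pl = [::] -> p \in pl -> p.2 = 0%R.
Proof.
move=> e0 ppl; apply/eqP; rewrite -absz_eq0; apply/negPn/negP => p0.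
suff : (p.1, (p.2 < 0)%R) \in expand pl by rewrite e0.
by apply/flatten_mapP; exists p => //; rewrite mem_nseq lt0n p0 eqxx.
Qed.

Lemma expand_fst (A : seq G) (f : G -> int) :
  [seq l.1 | l <- expand [seq (a, f a) | a <- A]] =
  flatten [seq nseq (absz (f a)) a | a <- A].
Proof.
by elim: A => //= a A IH; rewrite map_cat map_nseq IH.
Qed.

Lemma pairwise_nseq (le : rel G) (c : G -> nat) (A : seq G) :
  {in A, reflexive le} -> pairwise le A ->
  pairwise le (flatten [seq nseq (c a) a | a <- A]).
Proof.
elim: A => //= a A IH refl /andP[lea leA]; rewrite pairwise_cat; apply/and3P; split.
- apply/allrelP => x y; rewrite mem_nseq => /andP[_ /eqP ->] /flatten_mapP[z zA].
  by rewrite mem_nseq => /andP[_ /eqP ->]; apply: (allP lea).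
- have aa : le a a by apply: refl; rewrite inE eqxx.
  by elim: (c a) => //= k ->; rewrite andbT; apply/allP => z; rewrite mem_nseq => /andP[_ /eqP ->].
by apply: IH => // x xA; apply: refl; rewrite inE xA orbT.
Qed.

Lemma count_nseqs (c : G -> nat) (A : seq G) z : uniq A ->
  count_mem z (flatten [seq nseq (c a) a | a <- A]) = if z \in A then c z else 0.
Proof.
elim: A => //= a A IH /andP[naA uA]; rewrite count_cat count_nseq IH // in_cons /=.
rewrite (eq_sym z a); case: eqVneq => [<-|_]; first by rewrite (negbTE naA) mul1n addn0.
by [].
Qed.

End Expand.

Section Construction.
Variables (G : groupType) (A : seq G) (B : set G) (le : rel G).
Hypothesis uniqA : uniq A.
Hypothesis le_tot : total_order_on ([set` A] `|` B) le.
Hypothesis le_prec : precedes [set` A] B le.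
Hypothesis sortedA : sorted le A.

Let S := [set` A] `|` B.

Let SA a : a \in A -> S a. Proof. by left. Qed.

Let le_refl : {in A, reflexive le}.
Proof.
move=> a aA; case: le_tot => tot _ _.
by have := tot a a; rewrite !inE orbb; apply; left.
Qed.

Let le_anti x y : S x -> S y -> le x y -> le y x -> x = y.
Proof.
by case: le_tot => _ anti _ Sx Sy xy yx; apply: anti; rewrite ?inE ?xy.
Qed.

Let pairwiseA : pairwise le A.
Proof.
have trA : {in A & &, transitive le}.
  by case: le_tot => _ _ tr y x z yA xA zA; apply: tr; rewrite inE; apply: SA.
by rewrite -(sorted_pairwise_in trA (allss A)).
Qed.

Let BnA y : B y -> y \notin A.
Proof. by move=> By; apply/negP => yA; have := le_prec yA By; rewrite eqxx andbF. Qed.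

Let ucomm_zero y : y \notin A -> ucomm A y (fun=> 0%R) = y.
Proof.
move=> nyA; rewrite /ucomm (negbTE nyA) lcomm_expand /=.
suff -> : expand [seq (a, adjust y (fun=> 0%R) a) | a <- A] = [::] by [].
by elim: (A) => //= a s IH; rewrite /expand /= -/(expand _) IH /adjust ltxx andbF.
Qed.

(** A sorted index coherent word over A is determined by the signed
    multiplicities of its letters, which yields the reindexing of the
    U-construction.  For b in A the condition b > a_1 says that some
    letter before b has a nonzero exponent. *)
Lemma ucomm_construction g :
  (B `|` U_construction le [set` A] B) g <->
  exists y tau, [/\ S y, nontrivial A y tau & g = ucomm A y tau].
Proof.
split.
  case=> [Bg|]; first exists g, (fun=> 0%R).
    split; [by right | by rewrite /nontrivial BnA |].
    by rewrite ucomm_zero ?BnA.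
  case=> -[b e] [a [s [[/= Sb LA /andP[leab neab] sortL] [Be coh ->]]]].
  set L := a :: s in LA sortL coh *.
  pose sg z := (z, true) \in L.
  pose c z := count_mem z [seq l.1 | l <- L].
  pose d z : int := (if sg z then - (c z)%:Z else (c z)%:Z)%R.
  have dc z : absz (d z) = c z by rewrite /d; case: ifP; lia.
  have sgE l : l \in L -> l.2 = sg l.1.
    move=> lL; case: l lL => z [] lL /=; first by rewrite /sg lL.
    case zL: (sg z) => //; apply: (coh (z, false) (z, true)) => //.
      by rewrite in_cons lL orbT.
    by rewrite in_cons; move: zL; rewrite /sg => ->; rewrite orbT.
  have defL : L = expand [seq (z, d z) | z <- A].
    have fstL : [seq l.1 | l <- L] = flatten [seq nseq (c z) z | z <- A].
      have LcA : {subset [seq l.1 | l <- L] <= A} by move=> _ /mapP[l lL ->]; apply: LA.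
      case: le_tot => _ anti tr.
      apply: (@sorted_eq_in _ le) => [y x z xL yL zL|x y xL yL|||].
      - by apply: tr; rewrite inE; apply/SA/LcA.
      - by apply: anti; rewrite inE; apply/SA/LcA.
      - exact: sortL.
      - exact/pairwise_sorted/pairwise_nseq.
      apply/allP => z _ /=; rewrite count_nseqs //; case: ifP => // /negbT zA.
      have /count_memPn cz : z \notin [seq l.1 | l <- L] by apply: contra zA; apply: LcA.
      by apply/eqP; exact: cz.
    have -> : L = [seq (z, sg z) | z <- [seq l.1 | l <- L]].
      rewrite -map_comp -[LHS]map_id; apply/eq_in_map => l lL /=.
      by rewrite -(sgE l lL); case: (l).
    rewrite fstL /expand map_flatten -!map_comp; congr flatten.
    apply/eq_in_map => z zA /=; rewrite map_nseq dc.
    case cz: (c z) => [|k] //; congr (nseq _ (_, _)).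
    by rewrite /d cz; case: (sg z); lia.
  pose tau z : int := if (z == b) && e then (d z - 1)%R else d z.
  have eA : e -> b \in A.
    by case: Sb => // Bb; rewrite (Be Bb).
  have d_lt : (d b < 0)%R -> e.
    rewrite /d; case: ifP => // sb _.
    apply: (coh (b, e) (b, true)) => //; first by rewrite in_cons eqxx.
    by rewrite in_cons; move: sb; rewrite /sg => ->; rewrite orbT.
  have d_gt : e -> (d b <= 0)%R.
    move=> et; rewrite /d; case: ifP => // sb; first by lia.
    suff /eqP -> : c b == 0%N by [].
    apply/eqP/count_memPn/mapP => -[l lL bl].
    have := coh (b, e) l (mem_head _ _); rewrite in_cons lL orbT => /(_ isT bl) /=.
    by rewrite (sgE l lL) -bl sb et.
  have ltau : (b \in A) && (tau b < 0)%R = e.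
    rewrite /tau eqxx /=; case: (e) d_lt d_gt eA => d_lt d_gt eA.
      by rewrite eA //; have := d_gt isT; lia.
    by apply/negbTE/negP => /andP[_ /d_lt].
  have adj z : adjust b tau z = d z.
    rewrite /adjust /tau; case: eqP => [->|] //=; case: (e) d_lt d_gt => d_lt d_gt.
      by have := d_gt isT; case: ifP; lia.
    by case: ifP => // /d_lt.
  exists b, tau; split=> //; last first.
    rewrite /ucomm ltau lcomm_expand (eq_map (g := fun z => (z, d z))) -?defL //.
    by move=> z; rewrite adj.
  have [bA|nbA] := boolP (b \in A); last by rewrite /nontrivial nbA.
  have aA : a.1 \in A by apply: LA; rewrite in_cons eqxx.
  rewrite /nontrivial bA /=; apply/hasP; exists a.1; last first.
    rewrite /tau (negbTE neab) /= -absz_gt0 dc -has_count; apply/hasP.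
    by exists a.1; rewrite //= in_cons eqxx.
  move: aA; rewrite -{1}(cat_take_drop (index b A) A) mem_cat => /orP[//|].
  rewrite (drop_nth 1) ?index_mem // nth_index // in_cons (negbTE neab) /= => aA2.
  move: pairwiseA; rewrite -{1}(cat_take_drop (index b A) A).
  rewrite (drop_nth 1) ?index_mem // nth_index //.
  rewrite pairwise_cat /= => /and4P[_ _ /allP/(_ _ aA2) leba _].
  have aA : a.1 \in A by apply: mem_drop aA2.
  by move: neab; rewrite (le_anti (SA aA) (SA bA) leab leba) eqxx.
move=> [y [tau [Sy nt ->]]].
rewrite /ucomm lcomm_expand; set L := expand _.
have LA l : l \in L -> exists a,
    [/\ a \in A, adjust y tau a != 0%R & l = (a, (adjust y tau a < 0)%R)].
  by move=> /mem_expand[p [/mapP[a aA ->] nz ->]]; exists a.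
have sortL : sorted le [seq l.1 | l <- L].
  by rewrite expand_fst; exact/pairwise_sorted/pairwise_nseq.
pose A1 := take (index y A) A; pose A2 := drop (index y A) A.
have [headL L0] : (forall l s, L = l :: s -> le l.1 y && (l.1 != y)) /\ (L = [::] -> y \notin A).
  have [yA|nyA] := boolP (y \in A); last first.
    split=> // l s defL; have [|a [aA _ ->]] := LA l; first by rewrite defL in_cons eqxx.
    by apply: le_prec => //; case: Sy nyA => // -> .
  have A1y a : a \in A1 -> le a y && (a != y).
    have defA : A = A1 ++ y :: drop (index y A).+1 A.
      by rewrite -[LHS](cat_take_drop (index y A)) (drop_nth 1) ?index_mem ?nth_index.
    move=> aA1; move: pairwiseA uniqA; rewrite defA pairwise_cat cat_uniq.
    move=> /and3P[/allrelP/(_ a y aA1 (mem_head _ _)) -> _ _].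
    by move=> /and3P[_ /hasPn/(_ y) ny _]; apply: contraTneq aA1 => ->; apply: ny; exact: mem_head.
  have defL : L = expand [seq (a, adjust y tau a) | a <- A1] ++
                  expand [seq (a, adjust y tau a) | a <- A2].
    by rewrite /L -expand_cat -map_cat cat_take_drop.
  case defL1: (expand [seq (a, adjust y tau a) | a <- A1]) => [|k r].
    move: nt; rewrite /nontrivial yA /= => /hasP[a aA1] /negP[].
    have := expand_nil defL1 (map_f _ aA1); rewrite /= /adjust.
    by have /andP[_ /negbTE ->] := A1y a aA1 => /= ->.
  split=> [l s|]; rewrite defL defL1 // => -[<- _].
  have [|p [/mapP[a aA1 ->] _ ->]] := @mem_expand G k [seq (a, adjust y tau a) | a <- A1].
    by rewrite defL1 in_cons eqxx.
  exact: A1y.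
case defL: L => [|a s].
  left; have nyA := L0 defL; rewrite (negbTE nyA) /=.
  by case: Sy nyA => // ->.
right; exists (y, (y \in A) && (tau y < 0)%R), a, s; split; split=> //.
- by move=> l; rewrite -defL => /LA[x [xA _ ->]].
- exact: headL defL.
- by rewrite -defL.
- by move=> /BnA /= /negbTE ->.
- pose sg x := if x == y then (y \in A) && (tau y < 0)%R else (adjust y tau x < 0)%R.
  suff sgE l : l \in [:: (y, (y \in A) && (tau y < 0)%R), a & s] -> l.2 = sg l.1.
    by move=> k l /sgE -> /sgE -> ->.
  rewrite in_cons -defL => /orP[/eqP ->|/LA[x [xA nz ->]]] /=; first by rewrite /sg eqxx.
  rewrite /sg; case: eqP => // xy; move: nz; rewrite /adjust xy eqxx /= -xy xA /=.
  by case: ifP; lia.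
Qed.

End Construction.

(** * The theorem *)

(** K contains B and the commutators of R and no nontrivial monomial, so it is
    the kernel of the map of R onto the free abelian group on A that kills B. *)
Theorem U_construction_basis (G : groupType) (A : seq G) (B : set G) (le : rel G)
    (R K : set G) : uniq A ->
  total_order_on ([set` A] `|` B) le -> precedes [set` A] B le -> sorted le A ->
  free_basis R ([set` A] `|` B) -> is_subgroup K -> K `<=` R -> B `<=` K ->
  (forall r r', R r -> R r' -> K [~ r, r']) ->
  (forall tau, K (monomial A tau) -> forall a, a \in A -> tau a = 0%R) ->
  free_basis K (B `|` U_construction le [set` A] B).
Proof.
move=> uniqA le_tot le_prec sortedA bR sK KR BK commK Kmono.
have Uchar := ucomm_construction uniqA le_tot le_prec sortedA.
set T := B `|` _; set S := [set` A] `|` B in bR.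
have sR : is_subgroup R by case: bR => <- _; apply: generated_subgroup.
have SR : S `<=` R by case: bR => <- _; apply: mem_generated.
have AR : [set` A] `<=` R by move=> a aA; apply: SR; left.
have TK : T `<=` K.
  move=> g /Uchar[y [tau [Sy nt ->]]].
  apply: (ucomm_mem uniqA sR SR AR sK KR) => // z [zA|Bz] nzA; last exact: BK.
  by move: nzA; rewrite zA.
split=> [|s sT reds s0]; last first.
  have AS : [set` A] `<=` S by move=> a aA; left.
  apply: (ucomm_free uniqA bR AS) => // l ls.
  exact/Uchar/sT.
apply/seteqP; split; first exact: generated_sub.
move=> r Kr; have sT := generated_subgroup T.
have [||tau Htau] := schreier_transversal uniqA (S := S) sT _ (r := r).
- move=> y tau Sy nt; apply: (schreier_mem uniqA sT nt) => tau' nt' _.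
  by apply: mem_generated; apply/Uchar; exists y, tau'.
- by case: bR => -> _; apply: KR.
have Km : K (monomial A tau).
  rewrite -[monomial A tau](mulKg r); apply: subgroupM => //; first exact: subgroupV.
  exact: generated_sub sK TK _ Htau.
by move: Htau; rewrite /monomial powprod_zero ?mulg1 //; exact: Kmono.
Qed.

Section Degree.
Variables (F : groupType) (n : nat) (x : 'I_n -> F).
Hypothesis x_inj : injective x.
Hypothesis x_basis : free_basis [set: F] (range x).

Lemma gamma2_comm (g h : F) : gamma 2 [~ g, h].
Proof. by apply: mem_generated; exists g => //; exists h. Qed.

(** The free basis acts on the integers, x_i by translation by 1 and the other
    generators trivially. *)
Lemma exponent_sum (i : 'I_n) : exists delta : F -> int,
  [/\ forall g h, delta (g * h) = (delta g + delta h)%R,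
      forall j, delta (x j) = (i == j)%:R%R &
      forall g, gamma 2 g -> delta g = 0%R].
Proof.
pose f (y : F) (z : int) : int := (z + (y == x i)%:R)%R.
pose f' (y : F) (z : int) : int := (z - (y == x i)%:R)%R.
have [|| rho [rhoS rho1 rhoM]] := @free_basis_action F (range x) setT int f f' x_basis.
- by move=> y _ z; rewrite /f /f' addrK.
- by move=> y _ z; rewrite /f /f' subrK.
have transl g z : rho g z = (z + rho g 0)%R.
  pose T := [set g | forall z, rho g z = (z + rho g 0)%R].
  suff : T g by apply.
  have : subgroup_generated (range x) g by case: x_basis => -> _.
  apply: generated_sub => [|y ry z']; last by rewrite !rhoS // /f add0r.
  apply/is_subgroupP; split=> [z'|h k Th Tk z']; first by rewrite !rho1 addr0.
  have TV u : rho k^-1 u = (u - rho k 0)%R.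
    have := Tk (rho k^-1 u); rewrite -rhoM // mulVg rho1 => e.
    by rewrite {2}e addrK.
  by rewrite !rhoM // !TV Th addrA.
have deltaM g h : rho (g * h) 0%R = (rho g 0 + rho h 0)%R by rewrite rhoM // transl.
have deltaV g : rho g^-1 0%R = (- rho g 0)%R.
  by apply/eqP; rewrite -addr_eq0 -deltaM mulVg rho1.
exists (fun g => rho g 0%R); split=> //.
  by move=> j; rewrite rhoS /f ?add0r ?(inj_eq x_inj) 1?eq_sym //; exists j.
move=> g; apply: (@generated_sub _ _ [set g | rho g 0%R = 0%R]) => [|_ [h _ [k _ <-]] /=].
  apply/is_subgroupP; split=> [|h k /= h0 k0]; first exact: rho1.
  by rewrite deltaM deltaV h0 k0 subr0.
by rewrite /commg /conjg !deltaM !deltaV; ring.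
Qed.

End Degree.

Theorem theorem2p3 (F : groupType) (n : nat) (x : 'I_n -> F)
    (x_inj : injective x) (x_basis : free_basis [set: F] (range x))
    (R : set F) (R_normal : is_normal_subgroup R)
    (R_fin : exists S : set F, finite_set S /\ R = normal_closure S)
    (N : option nat) (w : nat -> F)
    (w_inj : {in index_set N &, injective w})
    (w_basis : free_basis R (w @` index_set N))
    (t : nat) (t_le_n : (t <= n)%N) (t_le_N : `I_t `<=` index_set N)
    (w_lo : forall i : 'I_n, (i < t)%N ->
       exists d : int, d <> 0%R /\
         congruent_mod (gamma 2) (w i) (expgz (x i) d))
    (w_hi : forall i : nat, index_set N i -> (t <= i)%N -> gamma 2 (w i))
    (W1 W2 : set F)
    (W1E : W1 = w @` `I_t) (W2E : W2 = w @` (index_set N `\` `I_t))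
    (le : rel F) (le_total : total_order_on (W1 `|` W2) le)
    (le_prec : precedes W1 W2 le) :
  free_basis R (W1 `|` W2) /\
  free_basis (R `&` gamma 2) (W2 `|` U_construction le W1 W2).
Proof.
have WE : w @` index_set N = W1 `|` W2.
  rewrite W1E W2E -image_setU; congr (w @` _); apply/seteqP; split=> i.
    by move=> Ni; have [it|it] := pselect (`I_t i); [left | right].
  by case=> [/t_le_N|[]].
rewrite WE in w_basis; split=> //.
pose A := sort le [seq w i | i <- iota 0 t].
have inA a : (a \in A) <-> W1 a.
  rewrite mem_sort W1E; split=> [/mapP[i]|[i it <-]].
    by rewrite mem_iota /= => it ->; exists i.
  by apply: map_f; rewrite mem_iota.
have AE : [set` A] = W1 by apply/seteqP; split=> a; rewrite /= inA.
have uniqA : uniq A.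
  rewrite sort_uniq map_inj_in_uniq ?iota_uniq // => i j.
  by rewrite !mem_iota /= => it jt; apply: w_inj; rewrite inE; apply: t_le_N.
have sortA : sorted le A.
  apply: (@sort_sorted_in _ (mem (W1 `|` W2))); first by case: le_total.
  apply/allP => a aA; rewrite inE; left; apply/inA; by rewrite mem_sort.
have sg2 : is_subgroup (gamma 2 : set F) by apply: generated_subgroup.
have sR : is_subgroup R by case: R_normal.
rewrite -AE; rewrite -AE in le_total le_prec w_basis; apply: (U_construction_basis (R := R)) => //.
- exact: subgroup_setI.
- move=> b W2b; split.
    by case: w_basis => <- _; apply: mem_generated; right.
  by move: W2b; rewrite W2E => -[i [Ni nit] <-]; apply: w_hi => //; rewrite leqNgt; apply/negP.
- by move=> r r' Rr Rr'; split; [apply: subgroup_comm | apply: gamma2_comm].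
move=> tau [_ g2m] a /inA; rewrite W1E => -[j jt ja]; rewrite -ja.
have jn : (j < n)%N := leq_trans jt t_le_n.
have [delta [deltaM deltax delta0]] := exponent_sum x_inj x_basis (Ordinal jn).
have delta1 : delta 1 = 0%R by have := deltaM 1 1; rewrite mulg1; lia.
have deltaV g : delta g^-1 = (- delta g)%R.
  by have := deltaM g g^-1; rewrite mulgV delta1; lia.
have deltaX g d : delta (expgz g d) = (delta g * d)%R.
  have dX m : delta (g ^+ m) = (delta g * m%:Z)%R.
    by elim: m => [|m IH]; rewrite ?mulr0 // expgS deltaM IH; lia.
  by case: d => m; rewrite /expgz ?deltaV dX // NegzE; ring.
have deltaw i : (i < t)%N -> exists2 d : int, d <> 0%R & delta (w i) = (d * (j == i)%:R)%R.
  move=> it; have lin := leq_trans it t_le_n.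
  have [d [d0 cong]] := w_lo (Ordinal lin) it; exists d => //.
  have := delta0 _ cong; rewrite deltaM deltaV deltaX deltax /= => e.
  by move: e; rewrite -val_eqE /=; case: (j == i); lia.
have := delta0 _ g2m; rewrite /monomial /powprod big_map /=.
have -> : delta (\prod_(a <- A) expgz a (tau a)) = (\sum_(a <- A) delta a * tau a)%R.
  by elim: (A) => [|b s IH]; rewrite ?big_nil ?big_cons ?deltaM ?IH ?deltaX.
have wjA : w j \in A by apply/inA; rewrite W1E; exists j.
rewrite (bigD1_seq (w j)) //= big_seq_cond big1 ?addr0.
  have [d d0 ->] := deltaw j jt; rewrite eqxx mulr1 => /eqP.
  by rewrite mulf_eq0 => /orP[/eqP|/eqP].
move=> b /andP[/inA]; rewrite W1E => -[i it <-] wij.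
have [d _ ->] := deltaw i it; rewrite (_ : (j == i) = false) ?mulr0 ?mul0r //.
by apply: contraNF wij => /eqP ->.
Qed.
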